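(* Let $\|\cdot\|$ be a norm on $\mathbb R^d$ with conjugate norm $\|\cdot\|_*$. Let $\{\xi^t\}_{t=0}^\infty$ be a stationary Markov chain with values in $\mathbb R^d$ and unique invariant distribution $\pi$, uniformly geometrically ergodic with mixing time $\tau_{\text{mix}}$, i.e. $|\mathbb P\{\xi^t=z\mid\xi^0=z_0\}-\pi_z|\lesssim(1/2)^{t/\tau_{\text{mix}}}$ for all $t>0$ and all states $z_0,z$, and such that $$\mathbb E_\pi[\xi^t]=0\quad\text{and}\quad\|\xi^t\|_*^2\le\sigma^2 .$$ Then for any $N\ge1$, $$\mathbb E\left[\left\|N^{-1}\sum_{t=1}^N\xi^t\right\|_*^2\right]\lesssim N^{-1}R^2\sigma^2\tau_{\text{mix}},$$ where $R^2:=\max_{x\in\mathbb R^d:\|x\|=1}\hat V(0,x)$ and $\hat V$ is an arbitrary Bregman divergence with respect to $\|\cdot\|$.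
   Context: $\|y\|_*=\max_{\|z\|\le1}\langle y,z\rangle$. A Bregman divergence with respect to $\|\cdot\|$ is $\hat V(x,y)=\omega(y)-\omega(x)-\langle\omega'(x),y-x\rangle$, $\omega'(x)\in\partial\omega(x)$, where $\omega$ is a proper convex lower semicontinuous function, $1$-strongly convex with respect to $\|\cdot\|$; here it is considered on the unit ball of $\|\cdot\|$. $\pi_z$ is the mass of $\pi$ at $z$, $\tau_{\text{mix}}\in\mathbb N$. $a\lesssim b$ means $a\le Cb$ for a constant $C>0$; in the conclusion $C$ does not depend on $N,\sigma,\tau_{\text{mix}},R$ (it may depend on $\pi$ and on the constant hidden in the ergodicity assumption). *)

(* Defs.v *)
From HB Require Import structures.
From mathcomp Require Import all_boot all_order all_algebra.
From mathcomp Require Import all_classical all_reals all_analysis.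

Set Implicit Arguments.
Unset Strict Implicit.
Unset Printing Implicit Defensive.

Import Order.TTheory GRing.Theory Num.Theory.
Import numFieldNormedType.Exports.

Local Open Scope classical_set_scope.
Local Open Scope ring_scope.

Definition dotp (R : realType) (n : nat) (u v : 'rV[R]_n) : R :=
  \sum_(i < n) u 0 i * v 0 i.

(* The canonical norm `|x| of 'rV[R]_n is the sup norm; an arbitrary norm on
   R^n is therefore a function satisfying the axioms below. *)
Record is_norm (R : realType) (n : nat) (nrm : 'rV[R]_n -> R) : Prop := {
  is_norm_triangle : forall x y, nrm (x + y) <= nrm x + nrm y ;
  is_norm_homo : forall (a : R) x, nrm (a *: x) = `|a| * nrm x ;
  is_norm_eq0 : forall x, nrm x = 0 -> x = 0 }.

(* When nrm is a norm, the set is compact and nonempty, so that the supremum is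
   a maximum. *)
Definition dual_norm (R : realType) (n : nat) (nrm : 'rV[R]_n -> R)
    (y : 'rV[R]_n) : R :=
  sup [set dotp y z | z in [set z | nrm z <= 1]].

(* Convex functions are defined on all of R^n with values in \bar R and take the
   value +oo outside of their effective domain: a function considered only on a
   closed convex set, e.g. the unit ball of a norm, is extended by +oo. *)
Definition proper_fun (R : realType) (n : nat) (f : 'rV[R]_n -> \bar R) : Prop :=
  (forall x, f x != -oo%E) /\ (exists x, f x != +oo%E).

(* The coefficients 0 and 1 are harmless: 0 * +oo = 0 in \bar R. *)
Definition convex_efun (R : realType) (n : nat) (f : 'rV[R]_n -> \bar R) : Prop :=
  forall (x y : 'rV[R]_n) (l : R), 0 <= l <= 1 ->
    (f (l *: x + (1 - l) *: y)%R <= l%:E * f x + (1 - l)%:E * f y)%E.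

Definition strongly_convex (R : realType) (n : nat) (nrm : 'rV[R]_n -> R)
    (mu : R) (f : 'rV[R]_n -> \bar R) : Prop :=
  forall (x y : 'rV[R]_n) (l : R), 0 <= l <= 1 ->
    (f (l *: x + (1 - l) *: y)%R + (mu / 2 * l * (1 - l) * nrm (x - y) ^+ 2)%:E
       <= l%:E * f x + (1 - l)%:E * f y)%E.

Definition subdifferential (R : realType) (n : nat) (f : 'rV[R]_n -> \bar R)
    (x : 'rV[R]_n) : set 'rV[R]_n :=
  [set g | f x \is a fin_num /\
           forall y, (f x + (dotp g (y - x)%R)%:E <= f y)%E].

(* omega' is a selection of subgradients, constrained only at the points where
   the subdifferential is nonempty. *)
Record distance_generating (R : realType) (n : nat) (nrm : 'rV[R]_n -> R)
    (omega : 'rV[R]_n -> \bar R) (omega' : 'rV[R]_n -> 'rV[R]_n) : Prop := {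
  dg_proper : proper_fun omega ;
  dg_convex : convex_efun omega ;
  dg_lsc : lower_semicontinuous omega ;
  dg_strongly_convex : strongly_convex nrm 1 omega ;
  dg_subgradient : forall x, subdifferential omega x !=set0 ->
                     subdifferential omega x (omega' x) }.

Definition bregman (R : realType) (n : nat) (omega : 'rV[R]_n -> \bar R)
    (omega' : 'rV[R]_n -> 'rV[R]_n) (x y : 'rV[R]_n) : \bar R :=
  (omega y - omega x - (dotp (omega' x) (y - x)%R)%:E)%E.

(* The supremum is taken in \bar R: it is the maximum whenever the latter
   exists, and may be +oo. *)
Definition bregman_radius2 (R : realType) (n : nat) (nrm : 'rV[R]_n -> R)
    (omega : 'rV[R]_n -> \bar R) (omega' : 'rV[R]_n -> 'rV[R]_n) : \bar R :=
  ereal_sup [set bregman omega omega' 0 x | x in [set x | nrm x = 1]].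

Definition distribution_on (R : realType) (E : choiceType) (S : set E)
    (mu : E -> R) : Prop :=
  (forall z, S z -> 0 <= mu z) /\ (\esum_(z in S) (mu z)%:E = 1)%E.

Definition transition_matrix (R : realType) (E : choiceType) (S : set E)
    (p : E -> E -> R) : Prop :=
  forall x, S x -> distribution_on S (p x).

Definition invariant_law (R : realType) (E : choiceType) (S : set E)
    (p : E -> E -> R) (mu : E -> R) : Prop :=
  forall y, S y -> (\esum_(x in S) (mu x * p x y)%:E = (mu y)%:E)%E.

Definition unique_invariant_distribution (R : realType) (E : choiceType)
    (S : set E) (p : E -> E -> R) (mu : E -> R) : Prop :=
  [/\ distribution_on S mu, invariant_law S p mu &
      forall nu, distribution_on S nu -> invariant_law S p nu ->
        forall z, S z -> nu z = mu z].

(* A random vector is measurable iff its coordinates are.  The Markov property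
   is the product formula for the finite-dimensional laws. *)
Record markov_chain (R : realType) (n : nat) (dT : measure_display)
    (T : measurableType dT) (P : probability T R) (S : set 'rV[R]_n)
    (p : 'rV[R]_n -> 'rV[R]_n -> R) (mu : 'rV[R]_n -> R)
    (xi : nat -> T -> 'rV[R]_n) : Prop := {
  mc_measurable : forall t (i : 'I_n), measurable_fun setT (fun w => xi t w 0 i) ;
  mc_state : forall t w, S (xi t w) ;
  mc_init : forall z, S z -> P [set w | xi 0%N w = z] = (mu z)%:E ;
  mc_markov : forall (t : nat) (x : nat -> 'rV[R]_n), (forall s, S (x s)) ->
    P [set w | forall s, (s <= t.+1)%N -> xi s w = x s] =
    (P [set w | forall s, (s <= t)%N -> xi s w = x s] * (p (x t) (x t.+1))%:E)%E }.

Definition cond_prob (R : realType) (dT : measure_display)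
    (T : measurableType dT) (P : probability T R) (A B : set T) : R :=
  fine (P (A `&` B)) / fine (P B).

(* K is the constant hidden in the O-notation.  The conditional probability is
   elementary, hence only considered for z0 visited with positive probability;
   for a chain started from its invariant law these are the states charged by
   that law. *)
Definition uniformly_geometrically_ergodic (R : realType) (n : nat)
    (dT : measure_display) (T : measurableType dT) (P : probability T R)
    (S : set 'rV[R]_n) (mu : 'rV[R]_n -> R) (xi : nat -> T -> 'rV[R]_n)
    (K : R) (tau : nat) : Prop :=
  forall (t : nat) (z0 z : 'rV[R]_n), (0 < t)%N -> S z0 -> S z ->
    (0 < P [set w | xi 0%N w = z0])%E ->
    `|cond_prob P [set w | xi t w = z] [set w | xi 0%N w = z0] - mu z|
      <= K * (1 / 2) `^ (t%:R / tau%:R).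

(* Main.v *)
Require Import Defs.
From HB Require Import structures.
From mathcomp Require Import all_boot all_order all_algebra.
From mathcomp Require Import all_classical all_reals all_analysis.
From mathcomp Require Import measurable_realfun perm ring lra.

Set Implicit Arguments.
Unset Strict Implicit.
Unset Printing Implicit Defensive.

Import Order.TTheory GRing.Theory Num.Theory.
Import numFieldNormedType.Exports.

Local Open Scope classical_set_scope.
Local Open Scope ring_scope.

(** The constant may depend on pi, hence on the dimension d of the space that
    carries it, and this reduces the theorem to a scalar variance bound.

    Geometry.  The unit ball of the norm contains d vectors z_1, ..., z_d in which
    every point of the ball has coordinates of absolute value at most 2
    ([near_auerbach_basis]).  Hence the squared dual norm of y is at most
    4 d times the sum of the <y, z_i>^2 ([dual_norm_sqr_le]), while
    |<xi^t, z_i>| <= |sigma| almost surely.  On the other side of the inequality,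
    strong convexity forces R^2 >= 1/4 ([bregman_radius2_ge]), so that a bound by
    a multiple of sigma^2 tau / N is enough.

    Probability.  It remains to bound the variance of the sum of f(xi^1), ...,
    f(xi^N) by a multiple of N tau sigma^2, for f bounded by |sigma| and centred
    under pi.  Summing the pointwise ergodicity bound over all states at all
    times would only work for pi of finite entropy.  Instead it is used at one
    time T0 = k0 tau, with k0 depending on pi and K only: a finite set of states
    carries 7/8 of the mass of pi, the law of xi^T0 is close to pi on this set,
    and hence it gives little mass to the complement.  So the transition operator
    over T0 steps halves the sup norm of every centred function
    ([ergodic_contraction]).  Iterating it with the Markov property, the
    covariance of f(xi^s) and f(xi^(s+k)) is at most sigma^2 / 2^floor(k / T0)
    ([covariance_decay]); these bounds sum to at most 2 T0 sigma^2 over k, which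
    gives the variance bound ([variance_sum_le]). *)

(** * Norms, dual norms and Bregman radii on R^n *)

Section DotProduct.
Context (R : realType) (n : nat).
Implicit Types u v w : 'rV[R]_n.

Lemma dotpDl u v w : dotp (u + v) w = dotp u w + dotp v w.
Proof.
by rewrite /dotp -big_split; apply: eq_bigr => i _; rewrite mxE mulrDl.
Qed.

Lemma dotpZl (a : R) u v : dotp (a *: u) v = a * dotp u v.
Proof.
by rewrite /dotp mulr_sumr; apply: eq_bigr => i _; rewrite mxE mulrA.
Qed.

Lemma dotpZr (a : R) u v : dotp u (a *: v) = a * dotp u v.
Proof.
by rewrite /dotp mulr_sumr; apply: eq_bigr => i _; rewrite mxE mulrCA.
Qed.

Lemma dotp_suml (I : Type) (r : seq I) (F : I -> 'rV[R]_n) v :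
  dotp (\sum_(i <- r) F i) v = \sum_(i <- r) dotp (F i) v.
Proof.
elim: r => [|i r IH]; last by rewrite !big_cons dotpDl IH.
by rewrite !big_nil /dotp big1 // => i _; rewrite mxE mul0r.
Qed.

Lemma dotp_mulmx u (m : nat) (a : 'rV[R]_m) (Z : 'M[R]_(m, n)) :
  dotp u (a *m Z) = \sum_i a 0 i * dotp u (row i Z).
Proof.
rewrite /dotp; under eq_bigr do rewrite mxE mulr_sumr.
rewrite exchange_big; apply: eq_bigr => i _; rewrite mulr_sumr.
by apply: eq_bigr => j _; rewrite mxE mulrCA.
Qed.

End DotProduct.

Section NormEquivalence.
Context (R : realType) (n : nat) (nrm : 'rV[R]_n -> R) (Hn : is_norm nrm).

Lemma nrm0 : nrm 0 = 0.
Proof. by rewrite -[X in nrm X](scale0r 0) is_norm_homo // normr0 mul0r. Qed.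

Lemma nrmN x : nrm (- x) = nrm x.
Proof. by rewrite -scaleN1r is_norm_homo // normrN1 mul1r. Qed.

Lemma nrm_ge0 x : 0 <= nrm x.
Proof. by have := is_norm_triangle Hn x (- x); rewrite subrr nrm0 nrmN; lra. Qed.

Lemma nrm_gt0 x : x != 0 -> 0 < nrm x.
Proof.
move=> x0; rewrite lt_neqAle nrm_ge0 andbT eq_sym.
by apply: contra_neq x0 => /(is_norm_eq0 Hn).
Qed.

Lemma nrm_sum (I : Type) (r : seq I) (F : I -> 'rV[R]_n) :
  nrm (\sum_(i <- r) F i) <= \sum_(i <- r) nrm (F i).
Proof.
elim: r => [|i r IH]; first by rewrite !big_nil nrm0.
by rewrite !big_cons (le_trans (is_norm_triangle Hn _ _)) // lerD2l.
Qed.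

Lemma coord_le_norm (x : 'rV[R]_n) i : `|x 0 i| <= `|x|.
Proof.
rewrite [leRHS]/Num.norm /= mx_normrE.
by apply/bigmax_geP; right => /=; exists (0, i).
Qed.

Lemma nrm_le_norm : exists2 B : R, 0 < B & forall x, nrm x <= B * `|x|.
Proof.
have s0 : 0 <= \sum_(i < n) nrm (delta_mx 0 i).
  by apply: sumr_ge0 => i _; exact: nrm_ge0.
exists (1 + \sum_(i < n) nrm (delta_mx 0 i)) => [|x]; first by lra.
rewrite {1}(row_sum_delta x); apply: (le_trans (nrm_sum _ _)).
rewrite mulrDl mulr_suml mul1r ler_wpDl //; apply: ler_sum => i _.
by rewrite is_norm_homo // mulrC ler_wpM2l ?nrm_ge0 // coord_le_norm.
Qed.

Lemma nrm_continuous : continuous nrm.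
Proof.
have [B B0 nB] := nrm_le_norm.
move=> x; apply/(@cvgrPdist_lt _ _ _ _ (nbhs_filter x)) => e e0.
apply/nbhs_ballP; exists (e / B); first by rewrite /= divr_gt0.
move=> y; rewrite -ball_normE /= => h.
have : nrm (x - y) < e.
  by rewrite (le_lt_trans (nB _)) // mulrC -ltr_pdivlMr.
have := is_norm_triangle Hn (x - y) y; have := is_norm_triangle Hn (y - x) x.
rewrite !subrK -(nrmN (y - x)) opprB => h1 h2 h3.
by rewrite ltr_norml; apply/andP; split; lra.
Qed.

(** All norms on R^n are equivalent: nrm attains a positive minimum on the
    compact sup-norm sphere. *)
Lemma norm_le_nrm : exists2 M : R, 0 < M & forall x, `|x| <= M * nrm x.
Proof.
pose A := [set x : 'rV[R]_n | `|x| = 1].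
have cA : compact A.
  apply: bounded_closed_compact.
    by exists 1; split => // M M1 x /= ->; exact: ltW.
  have -> : A = (fun x : 'rV[R]_n => `|x|) @^-1` [set 1] by [].
  apply: closed_comp => [x _|]; first exact: norm_continuous.
  by have := @closed_eq R 1.
have nZ (x : 'rV[R]_n) : x != 0 -> A (`|x|^-1 *: x).
  by move=> x0; rewrite /A /= normrZ normfV normr_id mulVf // normr_eq0.
have [[a Aa]|A0] := pselect (A !=set0); last first.
  exists 1 => // x; have [->|x0] := eqVneq x 0; first by rewrite normr0 nrm0 mulr0.
  by case: A0; exists (`|x|^-1 *: x); exact: nZ.
have [c] := EVT_min_rV (ex_intro _ a Aa) cA (continuous_subspaceT nrm_continuous).
rewrite inE /A /= => c1 cmin.
have c0 : 0 < nrm c.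
  by apply: nrm_gt0; apply/eqP => c0; move: c1; rewrite c0 normr0; lra.
exists (nrm c)^-1 => [|x]; first by rewrite invr_gt0.
have [->|x0] := eqVneq x 0; first by rewrite normr0 nrm0 mulr0.
have := cmin (`|x|^-1 *: x); rewrite inE => /(_ (nZ x x0)).
rewrite is_norm_homo // normfV normr_id => h.
have nx : 0 < `|x| by rewrite normr_gt0.
by rewrite ler_pdivlMl // -ler_pdivlMr // mulrC.
Qed.

Lemma nrm_ball_bounded :
  exists2 M : R, 0 < M & forall x i, nrm x <= 1 -> `|x 0 i| <= M.
Proof.
have [M M0 hM] := norm_le_nrm; exists M => // x i x1.
apply: (le_trans (coord_le_norm x i)); apply: (le_trans (hM x)).
by rewrite -[leRHS]mulr1 ler_wpM2l // ltW.
Qed.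

(** Rows of the unit ball whose determinant is within a factor two of the
    largest possible: by Cramer's rule the coordinates of any point of the ball
    in these rows are quotients of two such determinants.  (An exact maximiser
    is an Auerbach basis; the factor two makes attainment superfluous.) *)
Lemma near_auerbach_basis : exists2 Z : 'M[R]_n,
  forall i, nrm (row i Z) <= 1 &
  forall z, nrm z <= 1 ->
    exists2 a : 'rV[R]_n, (forall i, `|a 0 i| <= 2) & z = a *m Z.
Proof.
have [M M0 bM] := nrm_ball_bounded.
pose ball_mx := [set Z : 'M[R]_n | forall i, nrm (row i Z) <= 1].
pose D := [set `|\det Z| | Z in ball_mx].
(* The Leibniz formula, with all entries of Z bounded by M. *)
have ubD : ubound D (\sum_(s : {perm 'I_n}) M ^+ n).
  move=> _ [Z bZ <-]; rewrite /determinant.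
  apply: (le_trans (ler_norm_sum _ _ _)); apply: ler_sum => s _.
  rewrite normrM normrX normrN1 expr1n mul1r normr_prod.
  rewrite -[n in M ^+ n]card_ord -prodr_const; apply: ler_prod => i _.
  by rewrite normr_ge0 /= (_ : Z i (s i) = row i Z 0 (s i)) ?bM // mxE.
have [B B0 hB] := nrm_le_norm.
have DB : D (`|\det (B^-1%:M : 'M[R]_n)|).
  exists (B^-1%:M) => // i; apply: (le_trans (hB _)).
  rewrite mulrC -ler_pdivlMr // mul1r.
  rewrite [leLHS]/Num.norm /= mx_normrE; apply/bigmax_leP; split => /=.
    by rewrite invr_ge0 ltW.
  move=> [j k] _; rewrite !mxE /=; case: eqP => _; rewrite ?mulr1n ?mulr0n ?normr0.
    by rewrite gtr0_norm ?invr_gt0.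
  by rewrite invr_ge0 ltW.
have hsD : has_sup D by split; [exists (`|\det (B^-1%:M : 'M[R]_n)|)|eexists; exact: ubD].
have D0 : 0 < sup D.
  apply: lt_le_trans (sup_upper_bound hsD DB).
  by rewrite normr_gt0 det_scalar expf_neq0 // invr_neq0 // gt_eqF.
(* The scalar matrix 1/B shows that the supremum of the determinants is
   positive, so half of it is exceeded by some Z. *)
have [_ [Z bZ <-] hZ] := sup_adherent (divr_gt0 D0 (ltr0n R 2)) hsD.
have dZ : 0 < `|\det Z| by apply: lt_trans hZ; lra.
have uZ : Z \in unitmx by rewrite unitmxE unitfE -normr_gt0.
exists Z => // z z1; exists (z *m invmx Z); last by rewrite mulmxKV.
move=> i.
(* Cramer's rule: the i-th coordinate of z is det Zi / det Z. *)
pose Zi := \matrix_(k, j) (if k == i then z 0 j else Z k j).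
have bZi : ball_mx Zi.
  move=> k; have [->|ki] := eqVneq k i.
    by rewrite (_ : row i Zi = z) //; apply/rowP => j; rewrite !mxE eqxx.
  rewrite (_ : row k Zi = row k Z) //; apply/rowP => j.
  by rewrite !mxE (negbTE ki).
have -> : (z *m invmx Z) 0 i = (\det Z)^-1 * \det Zi.
  rewrite /invmx uZ -scalemxAr mxE; congr (_ * _).
  rewrite (expand_det_row _ i) mxE; apply: eq_bigr => j _.
  rewrite !mxE eqxx; congr (_ * _); rewrite /cofactor; congr (_ * \det _).
  by apply/matrixP => k l; rewrite !mxE eq_sym (negbTE (neq_lift _ _)).
rewrite normrM normfV mulrC ler_pdivrMr //.
have : `|\det Zi| <= sup D by apply: (sup_upper_bound hsD); exists Zi.
by move: hZ; lra.
Qed.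

(** Boundedness of the ball is what makes the supremum defining the dual norm an
    upper bound of its set. *)
Lemma has_sup_dual (y : 'rV[R]_n) :
  has_sup [set dotp y z | z in [set z | nrm z <= 1]].
Proof.
have [M M0 bM] := nrm_ball_bounded; split.
  by exists (dotp y 0); exists 0 => //=; rewrite nrm0.
exists (\sum_i `|y 0 i| * M) => _ [z z1 <-]; apply: ler_sum => i _.
by apply: (le_trans (ler_norm _)); rewrite normrM ler_wpM2l // bM.
Qed.

Lemma dotp_le_dual_norm y z : nrm z <= 1 -> `|dotp y z| <= dual_norm nrm y.
Proof.
move=> z1; rewrite ler_norml; apply/andP; split.
  rewrite lerNl -mulN1r -dotpZr; apply: (sup_upper_bound (has_sup_dual y)).
  by exists (-1 *: z) => //=; rewrite scaleN1r nrmN.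
by apply: (sup_upper_bound (has_sup_dual y)); exists z.
Qed.

Lemma dual_norm_ge0 y : 0 <= dual_norm nrm y.
Proof. by apply: (le_trans (normr_ge0 (dotp y 0))); rewrite dotp_le_dual_norm // nrm0. Qed.

Lemma dual_norm_sqr_le (Z : 'M[R]_n) y :
  (forall z, nrm z <= 1 ->
    exists2 a : 'rV[R]_n, (forall i, `|a 0 i| <= 2) & z = a *m Z) ->
  dual_norm nrm y ^+ 2 <= 4 * n%:R * \sum_i dotp y (row i Z) ^+ 2.
Proof.
move=> hZ.
have le1 : dual_norm nrm y <= 2 * \sum_i `|dotp y (row i Z)|.
  apply: ge_sup; first by case: (has_sup_dual y).
  move=> _ [z /hZ[a ha ->] <-]; rewrite dotp_mulmx mulr_sumr.
  apply: ler_sum => i _; apply: (le_trans (ler_norm _)).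
  by rewrite normrM ler_wpM2r.
(* Cauchy-Schwarz against the constant vector, by expanding the square and
   using 2 |a b| <= a^2 + b^2. *)
have cs : (\sum_i `|dotp y (row i Z)|) ^+ 2 <=
    n%:R * \sum_i dotp y (row i Z) ^+ 2.
  rewrite expr2 mulr_suml.
  have -> : n%:R * \sum_i dotp y (row i Z) ^+ 2 =
    \sum_(i < n) \sum_(j < n)
       (dotp y (row i Z) ^+ 2 / 2 + dotp y (row j Z) ^+ 2 / 2).
    transitivity (\sum_(i < n) (n%:R * (dotp y (row i Z) ^+ 2 / 2)
      + \sum_(j < n) dotp y (row j Z) ^+ 2 / 2)); last first.
      by apply: eq_bigr => i _; rewrite big_split /= sumr_const card_ord mulr_natl.
    rewrite big_split /= sumr_const card_ord -mulr_sumr -mulr_suml.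
    by rewrite -[X in _ + X]mulr_natl; field.
  apply: ler_sum => i _; rewrite mulr_sumr; apply: ler_sum => j _.
  rewrite -(real_normK (num_real (dotp y (row i Z)))).
  rewrite -(real_normK (num_real (dotp y (row j Z)))).
  by have := sqr_ge0 (`|dotp y (row i Z)| - `|dotp y (row j Z)|); nra.
apply: (@le_trans _ _ ((2 * \sum_i `|dotp y (row i Z)|) ^+ 2)).
  by rewrite ler_sqr // nnegrE ?dual_norm_ge0 // mulr_ge0 // sumr_ge0.
by rewrite exprMn -mulrA (_ : 2 ^+ 2 = 4) ?ler_wpM2l //; lra.
Qed.

End NormEquivalence.

(** Strong convexity at the midpoint of 0 and x, combined with the subgradient
    inequality at that midpoint, leaves a quarter of the squared norm. *)
Lemma bregman_radius2_ge (R : realType) (d : nat) (nrm : 'rV[R]_d -> R)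
    (omega : 'rV[R]_d -> \bar R) (omega' : 'rV[R]_d -> 'rV[R]_d) :
  (0 < d)%N -> is_norm nrm -> distance_generating nrm omega omega' ->
  subdifferential omega 0 !=set0 ->
  ((1 / 4)%:E <= bregman_radius2 nrm omega omega')%E.
Proof.
move=> d0 Hn dg /(dg_subgradient dg) [w0 sg].
pose e : 'rV[R]_d := delta_mx 0 (Ordinal d0).
have e0 : e != 0.
  apply/eqP => /rowP/(_ (Ordinal d0)); rewrite !mxE !eqxx /= => /eqP.
  by rewrite oner_eq0.
pose x := (nrm e)^-1 *: e.
have ne := nrm_gt0 Hn e0.
have nx : nrm x = 1.
  by rewrite is_norm_homo // normfV gtr0_norm // mulVf // gt_eqF.
apply: (@le_trans _ _ (bregman omega omega' 0 x)); last first.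
  by apply: ereal_sup_ubound; exists x.
have := dg_strongly_convex dg x 0 (l := 1 / 2).
have -> : 0 <= (1 / 2 : R) <= 1 by apply/andP; split; lra.
move=> /(_ isT); rewrite scaler0 addr0 subr0 nx.
have := sg ((1 / 2) *: x); rewrite subr0 dotpZr.
have := (dg_proper dg).1 x.
rewrite /bregman subr0; move: w0.
case: (omega 0) => [w _||] //; case: (omega x) => [v _||] //.
- case: (omega ((1 / 2) *: x)) => [m||] //=.
  + rewrite -!EFinM -!EFinD !lee_fin => h1 h2.
    by move: h1 h2; set q := dotp _ _; lra.
- by move=> *; rewrite leey.
Qed.

(** * Countably valued random variables *)

Section CountableValued.
Context (R : realType) (dT : measure_display) (T : measurableType dT).
Context (P : probability T R) (E : Type) (S : set E).
Hypothesis S_countable : countable S.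

(** The type E carries no sigma-algebra; measurability of all level sets makes
    every real function of such a variable measurable. *)
Definition countably_valued (X : T -> E) : Prop :=
  (forall w, S (X w)) /\ (forall a, measurable [set w | X w = a]).

Definition pr (A : set T) : R := fine (P A).

Lemma prE A : measurable A -> (pr A)%:E = P A.
Proof. by move=> mA; rewrite /pr fineK // fin_num_measure. Qed.

Lemma pr_ge0 A : 0 <= pr A.
Proof. exact: fine_ge0. Qed.

Lemma pr_le A B : measurable A -> measurable B -> A `<=` B -> pr A <= pr B.
Proof. by move=> mA mB AB; rewrite -lee_fin !prE // le_measure // inE. Qed.

Lemma pr_setT : pr setT = 1.
Proof. by rewrite /pr probability_setT. Qed.

Lemma pr_set0 : pr set0 = 0.
Proof. by rewrite /pr measure0. Qed.

Lemma preimage_countable_layer (f : E -> nat) (X : T -> E) (n : nat) :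
  {in S &, injective f} -> (forall w, S (X w)) ->
  [set w | f (X w) = n] = set0 \/
  exists2 a, S a & [set w | f (X w) = n] = [set w | X w = a].
Proof.
move=> fi XS; have [[a [Sa fa]]|na] := pselect (exists a, S a /\ f a = n).
  right; exists a => //; apply/seteqP; split => w /= => [fw|->] //.
  by apply: fi; rewrite ?inE // fw fa.
left; apply/seteqP; split => w //= fw; apply: na; exists (X w); split => //.
Qed.

Lemma countably_valued_preimage (X : T -> E) (B : set E) :
  countably_valued X -> measurable (X @^-1` B).
Proof.
move=> [XS mX]; have [f fi] := countable_injP _ S_countable.
have -> : X @^-1` B = \bigcup_n ([set w | f (X w) = n] `&` X @^-1` B).
  apply/seteqP; split => [w Bw|w [n _ []//]].
  by exists (f (X w)).
apply: bigcupT_measurable => n.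
have [->|[a Sa ->]] := preimage_countable_layer n fi XS; first by rewrite set0I.
have [Ba|nBa] := pselect (B a).
  rewrite (_ : _ `&` _ = [set w | X w = a]) //.
  by apply/seteqP; split => [w []//|w /= Xw]; split => //=; rewrite Xw.
rewrite (_ : _ `&` _ = set0) //.
by apply/seteqP; split => // w /= [-> /nBa].
Qed.

Lemma countably_valued_measurable (X : T -> E) (f : E -> R) :
  countably_valued X -> measurable_fun setT (f \o X).
Proof.
move=> cX _ B _; rewrite setTI comp_preimage.
exact: countably_valued_preimage.
Qed.

Lemma bounded_integrable (Y : T -> R) (M : R) (D : set T) :
  measurable_fun setT Y -> (forall w, `|Y w| <= M) -> measurable D ->
  P.-integrable D (EFin \o Y).
Proof.
move=> mY bY mD; apply: measurable_bounded_integrable => //.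
- by rewrite -ge0_fin_numE // fin_num_measure.
- exact: measurable_funS mY.
- exists M; split; first exact: num_real.
  by move=> x Mx w _ /=; rewrite (le_trans (bY w)) // ltW.
Qed.

Lemma Rintegral_bound (Y : T -> R) (M : R) (A : set T) : measurable A ->
  P.-integrable A (EFin \o Y) -> (forall w, A w -> `|Y w| <= M) ->
  `|\int[P]_(w in A) Y w| <= M * pr A.
Proof.
move=> mA iY bY; apply: (le_trans (le_normr_Rintegral mA iY)).
rewrite -Rintegral_cst //; apply: le_Rintegral => //.
  exact: (integrable_norm iY).
apply: (@bounded_integrable _ `|M|) => //.
Qed.

Lemma Rintegral_sum (I : Type) (s : seq I) (F : I -> T -> R) :
  (forall i, P.-integrable setT (EFin \o F i)) ->
  \int[P]_w (\sum_(i <- s) F i w) = \sum_(i <- s) \int[P]_w F i w.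
Proof.
move=> iF; elim: s => [|i s IH].
  by rewrite big_nil; under eq_Rintegral do rewrite big_nil;
    rewrite Rintegral_cst // mul0r.
rewrite big_cons -IH -RintegralD //.
  by apply: eq_Rintegral => w _; rewrite big_cons.
have -> : EFin \o (fun w => \sum_(j <- s) F j w) =
    (fun w => \sum_(j <- s) (EFin \o F j) w)%E.
  by apply/funext => w /=; rewrite sumEFin.
exact: integrable_sum.
Qed.

Lemma integral_by_layers (f : E -> nat) (X : T -> E) (D : set T) (Y : T -> R) :
  {in S &, injective f} -> countably_valued X -> measurable D ->
  P.-integrable D (EFin \o Y) ->
  (\int[P]_(w in D) (Y w)%:E =
   \sum_(n <oo) \int[P]_(w in D `&` [set w | f (X w) = n]) (Y w)%:E)%E.
Proof.
move=> fi cX mD iY.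
have DE : D = \bigcup_n (D `&` [set w | f (X w) = n]).
  by apply/seteqP; split => [w Dw|w [n _ []//]]; exists (f (X w)).
rewrite {1}DE integral_bigcup //.
- move=> i j _ _ [w [[_ /= <-] [_ /= <-]]] //.
- move=> n; apply: measurableI => //.
  exact: (@countably_valued_preimage X (f @^-1` [set n])).
- by rewrite -DE.
Qed.

(** The law of total expectation, as a comparison principle: two integrals
    agree as soon as they agree on the events that fix the value of a countably
    valued variable. *)
Lemma Rintegral_by_values (X X' : T -> E) (D D' : set T) (Y Y' : T -> R) :
  countably_valued X -> countably_valued X' -> measurable D -> measurable D' ->
  P.-integrable D (EFin \o Y) -> P.-integrable D' (EFin \o Y') ->
  (forall a, S a -> \int[P]_(w in D `&` [set w | X w = a]) Y w =
                    \int[P]_(w in D' `&` [set w | X' w = a]) Y' w) ->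
  \int[P]_(w in D) Y w = \int[P]_(w in D') Y' w.
Proof.
move=> cX cX' mD mD' iY iY' h; have [f fi] := countable_injP _ S_countable.
congr fine; rewrite (integral_by_layers fi cX mD iY).
rewrite (integral_by_layers fi cX' mD' iY'); apply: eq_eseriesr => n _.
have intE (Z : T -> R) (A B : set T) : measurable A -> measurable B ->
    P.-integrable A (EFin \o Z) ->
    (\int[P]_(w in A `&` B) (Z w)%:E = (\int[P]_(w in A `&` B) Z w)%:E)%E.
  move=> mA mB iZ; rewrite fineK //; apply: integrable_fin_num.
    exact: measurableI.
  by apply: integrableS iZ => //; exact: measurableI.
have [[a [Sa fa]]|na] := pselect (exists a, S a /\ f a = n).
  have layer (Z : T -> E) : countably_valued Z ->
      [set w | f (Z w) = n] = [set w | Z w = a].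
    move=> [ZS _]; apply/seteqP; split => w /= => [fw|->] //.
    by apply: fi; rewrite ?inE // fw fa.
  by rewrite !layer // !intE ?h //; first [exact: cX'.2|exact: cX.2].
have layer (Z : T -> E) : countably_valued Z -> [set w | f (Z w) = n] = set0.
  move=> [ZS _]; apply/seteqP; split => w //= fw.
  by apply: na; exists (Z w); split.
by rewrite !layer // !setI0 !integral_set0.
Qed.

Lemma pr_by_values (X X' : T -> E) (D D' : set T) (c c' : R) :
  countably_valued X -> countably_valued X' -> measurable D -> measurable D' ->
  (forall a, S a -> c * pr (D `&` [set w | X w = a]) =
                    c' * pr (D' `&` [set w | X' w = a])) ->
  c * pr D = c' * pr D'.
Proof.
move=> cX cX' mD mD' h.
rewrite /pr -!Rintegral_cst //; apply: (Rintegral_by_values cX cX') => //.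
- by apply: (@bounded_integrable _ `|c|).
- by apply: (@bounded_integrable _ `|c'|).
- move=> a Sa; rewrite !Rintegral_cst; [exact: h| |];
    by apply: measurableI => //; first [exact: cX'.2|exact: cX.2].
Qed.

(** Equality of two laws up to scalars transfers to expectations of bounded
    functions. *)
Lemma Rintegral_by_law (X X' : T -> E) (D D' : set T) (c c' M : R) (f : E -> R) :
  countably_valued X -> countably_valued X' -> measurable D -> measurable D' ->
  (forall a, `|f a| <= M) ->
  (forall a, S a -> c * pr (D `&` [set w | X w = a]) =
                    c' * pr (D' `&` [set w | X' w = a])) ->
  c * \int[P]_(w in D) f (X w) = c' * \int[P]_(w in D') f (X' w).
Proof.
move=> cX cX' mD mD' fM h.
have iX (Z : T -> E) (e : R) B : countably_valued Z -> measurable B ->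
    P.-integrable B (EFin \o (fun w => e * f (Z w))).
  move=> cZ; apply: (@bounded_integrable _ (`|e| * M)) => [|w].
    by apply: (@countably_valued_measurable Z (fun a => e * f a)).
  by rewrite normrM ler_wpM2l.
have iX1 (Z : T -> E) B : countably_valued Z -> measurable B ->
    P.-integrable B (EFin \o (fun w => f (Z w))).
  move=> cZ; apply: (@bounded_integrable _ M) => //.
  exact: (@countably_valued_measurable Z f).
rewrite -!RintegralZl //; try exact: iX1.
apply: (Rintegral_by_values cX cX') => //; try exact: iX.
have piece (Z : T -> E) (e : R) B a : countably_valued Z -> measurable B ->
    \int[P]_(w in B `&` [set w | Z w = a]) (e * f (Z w)) =
    f a * (e * pr (B `&` [set w | Z w = a])).
  move=> cZ mB; rewrite mulrCA mulrA -Rintegral_cst; last first.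
    by apply: measurableI => //; exact: cZ.2.
  by apply: eq_Rintegral => w; rewrite inE => -[_ /= ->].
by move=> a Sa; rewrite !piece // h.
Qed.

End CountableValued.

(** Splitting off finitely many values of X leaves an error governed by the
    probability of the remaining ones. *)
Lemma Rintegral_finite_approx (R : realType) (dT : measure_display)
    (T : measurableType dT) (P : probability T R) (E : eqType) (S : set E)
    (X : T -> E) (D : set T) (f : E -> R) (M : R) (F : seq E) :
  countable S -> countably_valued S X -> measurable D ->
  (forall a, `|f a| <= M) -> uniq F ->
  `|\int[P]_(w in D) f (X w) -
    \sum_(b <- F) f b * pr P (D `&` [set w | X w = b])| <=
  M * (pr P D - \sum_(b <- F) pr P (D `&` [set w | X w = b])).
Proof.
move=> cS cX mD fM uF; pose rest (G : seq E) := D `&` X @^-1` [set a | a \notin G].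
have mrest G : measurable (rest G).
  by apply: measurableI => //; exact: countably_valued_preimage cX.
have iX (g : E -> R) H A : (forall a, `|g a| <= H) -> measurable A ->
    P.-integrable A (EFin \o (fun w => g (X w))).
  move=> gH; apply: (@bounded_integrable _ _ _ P _ H) => [|w]; last exact: gH.
  exact: countably_valued_measurable cX.
have split_off (g : E -> R) H : (forall a, `|g a| <= H) ->
    \int[P]_(w in D) g (X w) = \sum_(b <- F) g b * pr P (D `&` [set w | X w = b])
      + \int[P]_(w in rest F) g (X w).
  move=> gH; elim: F uF => [_|b F IH /= /andP[bF uF]].
    rewrite big_nil add0r; congr Rintegral.
    by apply/seteqP; split => w //= [].
  rewrite big_cons (IH uF) -addrA addrCA; congr (_ + _).
  have restE : rest F = (D `&` [set w | X w = b]) `|` rest (b :: F).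
    apply/seteqP; split => w /=.
      move=> [Dw /= Xw]; have [->|Xb] := eqVneq (X w) b; first by left.
      by right; split => //=; rewrite inE negb_or Xb.
    move=> [[Dw /= Xb]|[Dw /=]]; first by split => //=; rewrite Xb.
    by rewrite inE negb_or => /andP[_ ?]; split.
  have mb : measurable (D `&` [set w | X w = b]).
    by apply: measurableI => //; exact: cX.2.
  rewrite restE Rintegral_setU //.
  - congr (_ + _); rewrite -Rintegral_cst //; apply: eq_Rintegral => w.
    by rewrite inE => -[_ /= ->].
  - by apply: iX gH _; exact: measurableU.
  - apply/disj_setPS => w [[_ /= Xb] [_ /=]].
    by rewrite Xb inE eqxx.
rewrite (split_off _ _ fM) addrC addKr.
have mass : pr P D = \sum_(b <- F) pr P (D `&` [set w | X w = b]) + pr P (rest F).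
  have := split_off (fun=> 1) 1; rewrite !Rintegral_cst // !mul1r.
  under eq_bigr do rewrite mul1r.
  by apply => _; rewrite normr1.
rewrite mass addrC addKr; apply: Rintegral_bound => //.
exact: iX fM _.
Qed.

Lemma probability_esum (R : realType) (dT : measure_display)
    (T : measurableType dT) (P : probability T R) (E : choiceType) (S : set E)
    (X : T -> E) (D : set T) :
  countable S -> countably_valued S X -> measurable D ->
  P D = (\esum_(a in S) P (D `&` [set w | X w = a]))%E.
Proof.
move=> cS cX mD; have [f fi] := countable_injP _ cS.
pose G n := P (D `&` [set w | f (X w) = n]).
transitivity (\sum_(n <oo) G n)%E.
  have {1}-> : D = \bigcup_n (D `&` [set w | f (X w) = n]).
    by apply/seteqP; split => [w Dw|w [n _ []//]]; exists (f (X w)).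
  rewrite measure_bigcup //.
  - by apply: eq_eseriesl => n; rewrite in_setT.
  - move=> n _; apply: measurableI => //.
    exact: (@countably_valued_preimage _ _ _ S cS X (f @^-1` [set n])).
  - by move=> i j _ _ [w [[_ /= <-] [_ /= <-]]].
rewrite nneseries_esumT //.
transitivity (\esum_(n in f @` S) G n)%E.
  rewrite [RHS]esum_mkcond; apply: eq_esum => n _; case: ifPn => //.
  rewrite notin_setE => nS; rewrite /G (_ : _ `&` _ = set0) ?measure0 //.
  apply/seteqP; split => // w [_ /= fw]; apply: nS; exists (X w) => //.
  exact: cX.1.
rewrite esum_image //; apply: eq_esum => a Sa; rewrite /G; congr (P (D `&` _)).
apply/seteqP; split => w /= => [|->] // fw.
by apply: fi; rewrite ?inE //; exact: cX.1.
Qed.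

(** * Markov chains on a countable state space *)

Section MarkovChain.
Context (R : realType) (n : nat) (dT : measure_display) (T : measurableType dT).
Context (P : probability T R) (S : set 'rV[R]_n) (S_countable : countable S).
Context (p : 'rV[R]_n -> 'rV[R]_n -> R) (mu : 'rV[R]_n -> R).
Context (xi : nat -> T -> 'rV[R]_n) (MC : markov_chain P S p mu xi).

Implicit Types (f g : 'rV[R]_n -> R) (M G : R) (A : set T).

Local Notation pr := (pr P).
Local Notation at_ t a := [set w | xi t w = a].

Lemma chain_countably_valued t : countably_valued S (xi t).
Proof.
split=> [w|a]; first exact: (mc_state MC).
have -> : at_ t a = \bigcap_(i in [set: 'I_n]) [set w | xi t w 0 i = a 0 i].
  apply/seteqP; split => [w /= wa i _ /=|w h].
    by rewrite wa.
  by apply/rowP => i; exact: (h i).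
apply: fin_bigcap_measurable => [|i _]; first exact: finite_finset.
have := mc_measurable MC t i measurableT (measurable_set1 (a 0 i)).
by rewrite setTI.
Qed.

Local Hint Resolve chain_countably_valued : core.

Lemma at_measurable t a : measurable (at_ t a).
Proof. exact: (chain_countably_valued t).2. Qed.

Local Hint Resolve at_measurable : core.

(** Membership in the sigma-algebra generated by xi 0, ..., xi t, expressed
    through trajectories: A is a union of level sets of (xi 0, ..., xi t). *)
Definition past (t : nat) (A : set T) : Prop :=
  measurable A /\
  forall w w', (forall s, (s <= t)%N -> xi s w = xi s w') -> A w -> A w'.

Lemma past_mono s t A : (s <= t)%N -> past s A -> past t A.
Proof.
move=> st [mA hA]; split => // w w' h; apply: hA => r rs.
by apply: h; exact: leq_trans st.
Qed.

Lemma pastT t : past t setT.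
Proof. by split. Qed.

Lemma past_at s t A a : (s <= t)%N -> past t A -> past t (A `&` at_ s a).
Proof.
move=> st [mA hA]; split; first exact: measurableI.
by move=> w w' h [Aw /= <-]; split; [exact: hA Aw|rewrite /= h].
Qed.

Let path (j m : nat) (x : nat -> 'rV[R]_n) : set T :=
  [set w | forall s, (j <= s <= m)%N -> xi s w = x s].

Let path_measurable j m x : measurable (path j m x).
Proof.
rewrite (_ : path j m x =
    \bigcap_(s in [set s | (j <= s <= m)%N]) at_ s (x s)).
  by apply: bigcap_measurableType => s _.
by apply/seteqP; split => w.
Qed.

Let markov_path t j x A : (j <= t)%N -> past t A -> (forall s, S (x s)) ->
  pr (A `&` path j t.+1 x) = pr (A `&` path j t x) * p (x t) (x t.+1).
Proof.
move=> jt pA; elim: j jt x => [|j IH] jt x Sx.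
  have sub : path 0 t.+1 x `<=` path 0 t x.
    by move=> w h s /= st; apply: h => /=; exact: leq_trans st _.
  (* A either contains all w that follow x up to time t, or none of them. *)
  have [[w0 [Aw0 pw0]]|no] := pselect (exists w, (A `&` path 0 t x) w).
    have AI : path 0 t x `<=` A.
      move=> w pw; apply: pA.2 Aw0 => s st.
      by rewrite pw0 /= ?st // pw /= ?st.
    rewrite !setIidr //; last exact: subset_trans AI.
    have pathE m : path 0 m x = [set w | forall s, (s <= m)%N -> xi s w = x s].
      by [].
    by rewrite /pr !pathE (mc_markov MC) // fineM ?fin_num_measure // -pathE.
  rewrite [X in _ = pr X * _](_ : _ = set0); last first.
    by apply/seteqP; split => // w h; apply: no; exists w.
  rewrite [X in pr X](_ : _ = set0) ?pr_set0 ?mul0r //.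
  by apply/seteqP; split => // w [Aw pw]; apply: no; exists w; split => //; exact: sub.
(* Sum over the value a of xi j; x' is the trajectory extended to time j. *)
rewrite mulrC -[LHS]mul1r.
apply: (@pr_by_values _ _ _ P _ S S_countable (xi j) (xi j)) => //.
- by apply: measurableI => //; exact: pA.1.
- by apply: measurableI => //; exact: pA.1.
move=> a Sa; pose x' s := if s == j then a else x s.
have pathE m : (j < m)%N -> A `&` path j.+1 m x `&` at_ j a = A `&` path j m x'.
  move=> jm; apply/seteqP; split => w [].
    move=> [Aw pw] /= wa; split => // s /= /andP[js sm]; rewrite /x'.
    by case: eqVneq => [->//|sj]; apply: pw; rewrite /= sm ltn_neqAle eq_sym sj js.
  move=> Aw pw; split; last first.
    by rewrite /= pw /x' ?eqxx //= leqnn ltnW.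
  split=> // s /= /andP[js sm].
  by rewrite pw /x' /= ?(ltnW js) // gtn_eqF.
rewrite mul1r !pathE // ?(ltn_trans jt) // IH ?(ltnW jt) //; last first.
  by move=> s; rewrite /x'; case: ifP.
by rewrite /x' !gtn_eqF // ?(ltn_trans jt) // mulrC.
Qed.

(** The defining product formula for complete trajectories extends to any event
    of the past, by summing out one time at a time starting from time 0. *)
Lemma markov_step t A a b : past t A -> S a -> S b ->
  pr (A `&` at_ t a `&` at_ t.+1 b) = pr (A `&` at_ t a) * p a b.
Proof.
move=> pA Sa Sb; pose x s := if (s <= t)%N then a else b.
have xt : x t = a by rewrite /x leqnn.
have xt1 : x t.+1 = b by rewrite /x ltnn.
have path1 : at_ t a = path t t x.
  apply/seteqP; split => w /= => [wa s|h]; last by rewrite h ?leqnn.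
  by rewrite -eqn_leq => /eqP <-; rewrite wa.
have path2 : at_ t a `&` at_ t.+1 b = path t t.+1 x.
  apply/seteqP; split => w /= => [[wa wb] s /andP[ts]|h].
    rewrite leq_eqVlt ltnS => /predU1P[->|st]; first by rewrite wb.
    by rewrite (_ : s = t) ?wa //; apply/eqP; rewrite eqn_leq st.
  by rewrite !h ?leqnn ?leqnSn.
rewrite -setIA path2 path1 markov_path ?xt ?xt1 // => s.
by rewrite /x; case: ifP.
Qed.

(** The Markov property at time t over k steps, with the transition
    probability written as a joint law of the chain itself; clearing the
    denominator mu a covers the states that are never visited. *)
Lemma markov_k_steps k t A a b : past t A -> S a -> S b ->
  mu a * pr (A `&` at_ t a `&` at_ (t + k)%N b) =
  pr (A `&` at_ t a) * pr (at_ 0 a `&` at_ k b).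
Proof.
move=> pA Sa; have mu0 : pr (at_ 0 a) = mu a by rewrite /pr (mc_init MC).
elim: k b => [|k IH] b Sb.
  rewrite addn0; have [->|ab] := eqVneq b a.
    by rewrite -setIA !setIid mu0 mulrC.
  have e0 s : at_ s a `&` at_ s b = set0.
    by apply/seteqP; split => // w /= [-> ba]; rewrite ba eqxx in ab.
  by rewrite -setIA !e0 setI0 !pr_set0 !mulr0.
have pB : past (t + k)%N (A `&` at_ t a).
  by apply: (@past_mono t); [exact: leq_addr|exact: past_at].
have p0 : past k (at_ 0 a).
  by rewrite -[at_ 0 a]setTI; apply: past_at => //; exact: pastT.
rewrite addnS; apply: (@pr_by_values _ _ _ P _ S S_countable (xi (t + k)%N) (xi k)) => //.
- by apply: measurableI => //; exact: pB.1.
- exact: measurableI.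
move=> e Se.
rewrite setIAC (markov_step pB Se Sb) (setIAC (at_ 0 a)) (markov_step p0 Se Sb).
by rewrite !mulrA IH.
Qed.

Lemma stationary (mu_inv : invariant_law S p mu) t b :
  S b -> pr (at_ t b) = mu b.
Proof.
have mu0 a : S a -> pr (at_ 0 a) = mu a by move=> Sa; rewrite /pr (mc_init MC).
have step s a c : S a -> S c -> pr (at_ s.+1 c `&` at_ s a) = pr (at_ s a) * p a c.
  by move=> Sa Sc; rewrite setIC -[at_ s a]setTI markov_step //; exact: pastT.
elim: t b => [|t IH] b Sb; first exact: mu0.
have p1 : pr (at_ 1 b) = mu b.
  apply: EFin_inj; rewrite prE // (probability_esum P S_countable (chain_countably_valued 0)) //.
  rewrite -mu_inv //; apply: eq_esum => a Sa.
  by rewrite -prE ?step ?mu0 //; exact: measurableI.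
rewrite -p1 -[LHS]mul1r -[RHS]mul1r.
apply: (@pr_by_values _ _ _ P _ S S_countable (xi t) (xi 0%N)) => //.
by move=> a Sa; rewrite !mul1r !step // IH // mu0.
Qed.

Lemma stationary_Rintegral (mu_inv : invariant_law S p mu) t f M :
  (forall a, `|f a| <= M) ->
  \int[P]_w f (xi t w) = \int[P]_w f (xi 0 w).
Proof.
move=> fM; rewrite -[LHS]mul1r -[RHS]mul1r.
apply: (@Rintegral_by_law _ _ _ P _ S S_countable (xi t) (xi 0%N) _ _ _ _ M) => //.
by move=> a Sa; rewrite !setTI !stationary.
Qed.

(** The k-th power of the transition operator, read off the chain.  The
    convention x / 0 = 0 makes it vanish at the states that are never visited,
    so that sup norm bounds hold everywhere. *)
Definition transition_op (k : nat) (f : 'rV[R]_n -> R) (a : 'rV[R]_n) : R :=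
  \int[P]_(w in at_ 0 a) f (xi k w) / mu a.

Lemma chain_integrable t f M A : (forall a, `|f a| <= M) -> measurable A ->
  P.-integrable A (EFin \o (fun w => f (xi t w))).
Proof.
move=> fM; apply: (@bounded_integrable _ _ _ P _ M) => [|w]; last exact: fM.
exact: (@countably_valued_measurable _ _ _ _ S S_countable (xi t) f).
Qed.

Lemma transition_op_bound k f M : (forall a, `|f a| <= M) ->
  forall a, `|transition_op k f a| <= M.
Proof.
move=> fM a; have M0 : 0 <= M by apply: le_trans (fM 0).
rewrite /transition_op; have [Sa|nSa] := pselect (S a); last first.
  rewrite (_ : at_ 0 a = set0) ?Rintegral_set0 ?mul0r ?normr0 //.
  apply/seteqP; split => // w /= wa; apply: nSa; rewrite -wa.
  exact: (mc_state MC).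
have mu0 : pr (at_ 0 a) = mu a by rewrite /pr (mc_init MC).
have [->|mua] := eqVneq (mu a) 0; first by rewrite invr0 mulr0 normr0.
have mup : 0 < mu a by rewrite lt_neqAle eq_sym mua -mu0 pr_ge0.
rewrite normrM normfV (gtr0_norm mup) ler_pdivrMr // -mu0.
by apply: Rintegral_bound => //; exact: (chain_integrable _ fM).
Qed.

(** The transition operator is the conditional expectation given the past: on
    each event fixing the value of xi t this is [markov_k_steps], integrated
    against f. *)
Lemma markov_operator (mu_inv : invariant_law S p mu) k t A f M :
  (forall a, `|f a| <= M) -> past t A ->
  \int[P]_(w in A) f (xi (t + k)%N w) =
  \int[P]_(w in A) transition_op k f (xi t w).
Proof.
move=> fM pA; have mA := pA.1.
apply: (@Rintegral_by_values _ _ _ P _ S S_countable (xi t) (xi t)) => //.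
- exact: (chain_integrable _ fM).
- by apply: (chain_integrable _ (transition_op_bound k fM)).
move=> a Sa; have mAa : measurable (A `&` at_ t a) by exact: measurableI.
transitivity (transition_op k f a * pr (A `&` at_ t a)); last first.
  rewrite -Rintegral_cst //; apply: eq_Rintegral => w.
  by rewrite inE => -[_ /= ->].
have [mua|mua] := eqVneq (mu a) 0.
  have z : pr (A `&` at_ t a) = 0.
    apply/eqP; rewrite eq_le pr_ge0 andbT -mua -(stationary mu_inv t Sa).
    by apply: pr_le => // w [].
  rewrite z mulr0; apply/eqP; rewrite -normr_eq0 eq_le normr_ge0 andbT.
  rewrite -(mulr0 M) -z; apply: Rintegral_bound => //.
  exact: (chain_integrable _ fM).
apply: (mulfI mua); rewrite mulrA (_ : mu a * transition_op k f a =
    \int[P]_(w in at_ 0 a) f (xi k w)); last by rewrite /transition_op mulrC divfK.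
rewrite [RHS]mulrC.
apply: (@Rintegral_by_law _ _ _ P _ S S_countable (xi (t + k)%N) (xi k) _ _ _ _ M) => //.
by move=> b Sb; exact: markov_k_steps.
Qed.

Lemma chain_prod_integrable s t f g M G : (forall a, `|f a| <= M) ->
  (forall a, `|g a| <= G) ->
  P.-integrable setT (EFin \o (fun w => f (xi t w) * g (xi s w))).
Proof.
move=> fM gG; apply: (@bounded_integrable _ _ _ P _ (M * G)) => //.
  by apply: measurable_funM;
    exact: (@countably_valued_measurable _ _ _ _ S S_countable).
by move=> w; rewrite normrM ler_pM.
Qed.

Lemma markov_covariance (mu_inv : invariant_law S p mu) k s t f g M G :
  (s <= t)%N -> (forall a, `|f a| <= M) -> (forall a, `|g a| <= G) ->
  \int[P]_w (f (xi (t + k)%N w) * g (xi s w)) =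
  \int[P]_w (transition_op k f (xi t w) * g (xi s w)).
Proof.
move=> st fM gG; have kM := transition_op_bound k fM.
apply: (@Rintegral_by_values _ _ _ P _ S S_countable (xi s) (xi s)) => //.
- exact: (chain_prod_integrable _ _ fM gG).
- exact: (chain_prod_integrable _ _ kM gG).
have piece t' (h : 'rV[R]_n -> R) H a : (forall b, `|h b| <= H) ->
    \int[P]_(w in setT `&` at_ s a) (h (xi t' w) * g (xi s w)) =
    \int[P]_(w in at_ s a) h (xi t' w) * g a.
  move=> hH; rewrite setTI -RintegralZr //; last exact: (chain_integrable _ hH).
  by apply: eq_Rintegral => w; rewrite inE /= => ->.
move=> a Sa; rewrite (piece _ _ _ _ fM) (piece _ _ _ _ kM); congr (_ * _).
apply: (markov_operator mu_inv _ fM).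
by rewrite -[at_ s a]setTI; apply: past_at => //; exact: pastT.
Qed.

(** * Variance of additive functionals under a contraction *)

Section Mixing.
Hypothesis mu_inv : invariant_law S p mu.
Variables (T0 : nat) (T0_gt0 : (0 < T0)%N).
Hypothesis contraction : forall f M, (forall a, `|f a| <= M) ->
  \int[P]_w f (xi 0 w) = 0 -> forall a, `|transition_op T0 f a| <= M / 2.

(** Each block of T0 steps replaces f by its image under the transition operator,
    which is again centred by stationarity and has half the bound. *)
Lemma covariance_decay k s f g M G :
  (forall a, `|f a| <= M) -> (forall a, `|g a| <= G) ->
  \int[P]_w f (xi 0 w) = 0 ->
  `|\int[P]_w (f (xi (s + k)%N w) * g (xi s w))| <= M * G / 2 ^+ (k %/ T0).
Proof.
elim/ltn_ind: k f M => k IH f M fM gG f0.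
have [kT|Tk] := ltnP k T0.
  rewrite divn_small // expr0 divr1 -[leRHS]mulr1 -(pr_setT P).
  apply: Rintegral_bound => //; first exact: (chain_prod_integrable _ _ fM gG).
  by move=> w _; rewrite normrM ler_pM.
have kM := contraction fM f0.
have := IH (k - T0)%N _ (transition_op T0 f) (M / 2) kM gG.
rewrite -(markov_covariance mu_inv T0 _ fM gG) ?leq_addr // -addnA subnK //.
have -> : (k %/ T0 = ((k - T0) %/ T0).+1)%N.
  by rewrite -{1}(subnK Tk) divnDr // divnn T0_gt0 addn1.
rewrite exprS invfM mulrA [M / 2 * G]mulrAC; apply.
  by rewrite ltn_subrL T0_gt0 (leq_trans T0_gt0).
have := markov_operator mu_inv T0 fM (pastT 0).
by rewrite add0n => <-; rewrite (stationary_Rintegral mu_inv _ fM).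
Qed.

(** A geometric series in which every term is repeated T0 times. *)
Lemma sum_half_pow_le N :
  \sum_(k < N) (1 : R) / 2 ^+ (k %/ T0) <= 2 * T0%:R.
Proof.
(* The subtracted term is the sum of the remaining terms k >= N. *)
have -> : \sum_(k < N) (1 : R) / 2 ^+ (k %/ T0) =
    2 * T0%:R - (2 * T0%:R - (N %% T0)%:R) / 2 ^+ (N %/ T0).
  elim: N => [|N IH]; first by rewrite big_ord0 mod0n div0n expr0 divr1 subr0 subrr.
  rewrite big_ord_recr /= IH divnS // modnS.
  have p2 : (2 ^+ (N %/ T0) : R) != 0 by rewrite expf_neq0 // pnatr_eq0.
  case: ifP => [dv|ndv].
    have Tm : T0 = (N %% T0).+1.
      apply/eqP; rewrite eqn_leq ltn_pmod // andbT.
      have : (T0 %| (N %% T0).+1)%N by rewrite /dvdn -addn1 modnDml addn1.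
      by move/dvdn_leq; apply.
    have Tr : T0%:R = (N %% T0)%:R + 1 :> R by rewrite natr1 -Tm.
    by rewrite add1n exprS Tr; field.
  by rewrite add0n -natr1; field.
rewrite gerBl divr_ge0 ?exprn_ge0 // subr_ge0 -natrM ler_nat.
by rewrite (leq_trans (ltnW (ltn_pmod _ T0_gt0))) // leq_pmull.
Qed.

(** Adding the term of index N+1 raises the second moment by its own second
    moment and twice its covariances with the past terms, together at most
    4 T0 M^2 by the two preceding lemmas. *)
Lemma variance_sum_le f M N : (forall a, `|f a| <= M) ->
  \int[P]_w f (xi 0 w) = 0 ->
  \int[P]_w (\sum_(1 <= t < N.+1) f (xi t w)) ^+ 2 <= 4 * T0%:R * M ^+ 2 * N%:R.
Proof.
move=> fM f0; have M0 : 0 <= M by apply: le_trans (fM 0).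
have mY m : measurable_fun setT (fun w => \sum_(1 <= t < m) f (xi t w)).
  apply: measurable_sum => t.
  exact: (@countably_valued_measurable _ _ _ _ S S_countable).
have bY m w : `|\sum_(1 <= t < m) f (xi t w)| <= M * m%:R.
  apply: (le_trans (ler_norm_sum _ _ _)); apply: (@le_trans _ _ (\sum_(1 <= t < m) M)).
    by apply: ler_sum => t _.
  by rewrite sumr_const_nat -[M *+ _]mulr_natr ler_wpM2l // ler_nat leq_subr.
have i2 (Y Z : T -> R) G H : measurable_fun setT Y -> measurable_fun setT Z ->
    (forall w, `|Y w| <= G) -> (forall w, `|Z w| <= H) ->
    P.-integrable setT (EFin \o (fun w => Y w * Z w)).
  move=> mY' mZ bY' bZ; apply: (@bounded_integrable _ _ _ P _ (G * H)) => //.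
    exact: measurable_funM.
  by move=> w; rewrite normrM ler_pM.
have mX t : measurable_fun setT (fun w => f (xi t w)).
  exact: (@countably_valued_measurable _ _ _ _ S S_countable).
elim: N => [|N IH].
  under eq_Rintegral do rewrite big_geq // expr0n.
  by rewrite Rintegral_cst // mul0r mulr0.
pose X w := f (xi N.+1 w); pose Y w := \sum_(1 <= t < N.+1) f (xi t w).
have iYY := i2 _ _ _ _ (mY N.+1) (mY N.+1) (bY N.+1) (bY N.+1).
have iXY := i2 _ _ _ _ (mX N.+1) (mY N.+1) (fun w => fM _) (bY N.+1).
have iXX := i2 _ _ _ _ (mX N.+1) (mX N.+1) (fun w => fM _) (fun w => fM _).
have -> : \int[P]_w (\sum_(1 <= t < N.+2) f (xi t w)) ^+ 2 =
    \int[P]_w (Y w * Y w) + (\int[P]_w (X w * Y w) + \int[P]_w (X w * Y w)) +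
    \int[P]_w (X w * X w).
  rewrite -!RintegralD //; last 2 first.
  - exact: (integrableD measurableT iYY (integrableD measurableT iXY iXY)).
  - exact: (integrableD measurableT iXY iXY).
  by apply: eq_Rintegral => w _; rewrite big_nat_recr //= -/(X w) -/(Y w); ring.
have hYY : \int[P]_w (Y w * Y w) <= 4 * T0%:R * M ^+ 2 * N%:R.
  by under eq_Rintegral do rewrite -expr2.
have hXX : \int[P]_w (X w * X w) <= M ^+ 2.
  apply: (le_trans (ler_norm _)); rewrite -[leRHS]mulr1 -(pr_setT P).
  apply: Rintegral_bound => // w _.
  by rewrite normrM expr2 ler_pM //; exact: fM.
have hXY : \int[P]_w (X w * Y w) <=
    M ^+ 2 * \sum_(1 <= k < N.+1) (1 : R) / 2 ^+ (k %/ T0).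
  have -> : \int[P]_w (X w * Y w) =
      \sum_(1 <= t < N.+1) \int[P]_w (X w * f (xi t w)).
    under eq_Rintegral do rewrite mulr_sumr.
    by apply: Rintegral_sum => // t; exact: (chain_prod_integrable _ _ fM fM).
  (* Reindexed by the lag between the times t and N+1. *)
  rewrite big_nat_rev /= mulr_sumr; apply: ler_sum_nat => t /andP[t1 tN].
  apply: (le_trans (ler_norm _)).
  have := covariance_decay t (N.+1 - t)%N fM fM f0.
  by rewrite subnK ?(ltnW tN) // add1n subSS expr2 mul1r.
(* The lag 0 is absent from this sum; the 1 it saves pays for the second moment
   of X. *)
have hs : \sum_(1 <= k < N.+1) (1 : R) / 2 ^+ (k %/ T0) <= 2 * T0%:R - 1.
  have := sum_half_pow_le N.+1.
  by rewrite -(big_mkord xpredT (fun k => 1 / 2 ^+ (k %/ T0))) big_ltn //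
    div0n expr0 divr1; lra.
have := ler_wpM2l (sqr_ge0 M) hs; rewrite -(natr1 N).
by have := sqr_ge0 M; lra.
Qed.
End Mixing.

End MarkovChain.

(** * Contraction from ergodicity *)

Section Contraction.
Context (R : realType) (n : nat) (dT : measure_display) (T : measurableType dT).
Context (P : probability T R) (S : set 'rV[R]_n) (S_countable : countable S).
Context (p : 'rV[R]_n -> 'rV[R]_n -> R) (mu : 'rV[R]_n -> R).
Context (xi : nat -> T -> 'rV[R]_n) (MC : markov_chain P S p mu xi).

Local Notation pr := (pr P).
Local Notation at_ t a := [set w | xi t w = a].

(** A set F of states that carries all but delta of the mass of mu, and on which
    the k-step law from a is eps-close to mu, controls the k-step law on the
    complement of F as well, since both laws have total mass 1. *)
Lemma transition_op_small k (f : 'rV[R]_n -> R) (M delta eps : R)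
    (F : seq 'rV[R]_n) :
  (forall a, `|f a| <= M) -> \int[P]_w f (xi 0 w) = 0 ->
  uniq F -> (forall b, b \in F -> S b) ->
  1 - delta <= \sum_(b <- F) mu b ->
  (forall a b, S a -> 0 < mu a -> b \in F ->
     `|pr (at_ 0 a `&` at_ k b) - mu a * mu b| <= eps * mu a) ->
  0 <= delta -> 0 <= eps ->
  forall a, `|transition_op P mu xi k f a| <=
    M * (2 * delta + 2 * (size F)%:R * eps).
Proof.
move=> fM f0 uF FS Fmass close d0 e0 a.
have M0 : 0 <= M by apply: le_trans (fM 0).
have mu0 b : S b -> pr (at_ 0 b) = mu b by move=> Sb; rewrite /pr (mc_init MC).
have rhs0 : 0 <= M * (2 * delta + 2 * (size F)%:R * eps).
  by rewrite mulr_ge0 // addr_ge0 ?mulr_ge0.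
rewrite /transition_op; have [Sa|nSa] := pselect (S a); last first.
  rewrite (_ : at_ 0 a = set0) ?Rintegral_set0 ?mul0r ?normr0 //.
  apply/seteqP; split => // w /= wa; apply: nSa; rewrite -wa.
  exact: (mc_state MC).
have [->|mua] := eqVneq (mu a) 0; first by rewrite invr0 mulr0 normr0.
have mup : 0 < mu a by rewrite lt_neqAle eq_sym mua -mu0 // pr_ge0.
rewrite normrM normfV (gtr0_norm mup) ler_pdivrMr //.
have cX := chain_countably_valued MC.
have h1 := Rintegral_finite_approx P S_countable (cX k) (at_measurable MC 0 a) fM uF.
have h2 := Rintegral_finite_approx P S_countable (cX 0%N) measurableT fM uF.
have muE : \sum_(b <- F) f b * pr (setT `&` at_ 0 b) = \sum_(b <- F) f b * mu b.
  by apply: eq_big_seq => b bF; rewrite setTI mu0 //; exact: FS.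
have muE' : \sum_(b <- F) pr (setT `&` at_ 0 b) = \sum_(b <- F) mu b.
  by apply: eq_big_seq => b bF; rewrite setTI mu0 //; exact: FS.
rewrite muE muE' f0 pr_setT sub0r normrN in h2.
rewrite mu0 // in h1.
pose q b := pr (at_ 0 a `&` at_ k b).
have cl b : b \in F -> `|q b - mu a * mu b| <= eps * mu a by exact: close.
have h3 : `|\sum_(b <- F) f b * q b - mu a * \sum_(b <- F) f b * mu b| <=
    M * ((size F)%:R * (eps * mu a)).
  rewrite mulr_sumr -sumrB; apply: (le_trans (ler_norm_sum _ _ _)).
  have -> : M * ((size F)%:R * (eps * mu a)) = \sum_(b <- F) M * (eps * mu a).
    by rewrite big_const_seq count_predT iter_addr_0 -[RHS]mulr_natl mulrCA.
  rewrite big_seq [leRHS]big_seq; apply: ler_sum => b bF.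
  rewrite [mu a * _]mulrCA -mulrBr normrM ler_pM //; exact: cl.
have h4 : mu a * \sum_(b <- F) mu b - (size F)%:R * (eps * mu a) <= \sum_(b <- F) q b.
  have -> : (size F)%:R * (eps * mu a) = \sum_(b <- F) (eps * mu a).
    by rewrite big_const_seq count_predT iter_addr_0 -[RHS]mulr_natl.
  rewrite mulr_sumr -sumrB big_seq [leRHS]big_seq; apply: ler_sum => b bF.
  by have := cl b bF; rewrite ler_norml => /andP[]; lra.
move: h1 h2 h3 h4; set I := Rintegral _ _ _.
set A := \sum_(b <- F) f b * q b; set B := \sum_(b <- F) f b * mu b.
set Q := \sum_(b <- F) pr _.
set m := \sum_(b <- F) mu b in Fmass *; set s := (size F)%:R.
move=> h1 h2 h3 h4.
(* Three errors: the mass outside F, the distance between the two laws on F, and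
   the integral B of f over F against mu, small because f is centred. *)
have t1 : `|I| <= `|I - A| + `|A - mu a * B| + mu a * `|B|.
  have -> : mu a * `|B| = `|mu a * B| by rewrite normrM gtr0_norm.
  have := ler_normD ((I - A) + (A - mu a * B)) (mu a * B).
  have := ler_normD (I - A) (A - mu a * B).
  by rewrite (_ : I - A + (A - mu a * B) + mu a * B = I); [lra|ring].
have g1 : M * (mu a - Q) <= M * (mu a - (mu a * m - s * (eps * mu a))).
  by rewrite ler_wpM2l //; move: h4; rewrite -/Q; lra.
have g2 : mu a * `|B| <= mu a * (M * (1 - m)) by rewrite ler_wpM2l // ltW.
have g3 : (mu a * M) * (1 - m) <= (mu a * M) * delta.
  apply: ler_wpM2l; first by rewrite mulr_ge0 // ltW.
  by move: Fmass; lra.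
lra.
Qed.

End Contraction.

Lemma finite_mass (R : realType) (E : choiceType) (S : set E) (mu : E -> R)
    (delta : R) : 0 < delta -> distribution_on S mu ->
  exists F : seq E, [/\ uniq F, forall b, b \in F -> S b &
    1 - delta <= \sum_(b <- F) mu b].
Proof.
move=> d0 [mu0 mu1].
have /ereal_sup_gt[_ [X [fX XS] <-]] :
    ((1 - delta)%:E < \esum_(z in S) (mu z)%:E)%E by rewrite mu1 lte_fin; lra.
rewrite fsbig_finite //= sumEFin lte_fin => h.
exists (finmap.enum_fset (fset_set X)).
split; [exact: finmap.fset_uniq| |exact: ltW].
by move=> b; rewrite in_fset_set // inE => /XS.
Qed.

(** The pointwise ergodicity bound only controls finitely many states at a time,
    and summing it over all states at every time would require the entropy of pi
    to be finite.  It is therefore used at a single time, a fixed multiple of the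
    mixing time: there it controls a finite set carrying most of the mass of pi,
    hence also the mass of the complement. *)
Lemma ergodic_contraction (R : realType) (n : nat) (S : set 'rV[R]_n)
    (mu : 'rV[R]_n -> R) (K : R) :
  countable S -> distribution_on S mu ->
  exists2 k0 : nat, (0 < k0)%N &
  forall (dT : measure_display) (T : measurableType dT) (P : probability T R)
    (p : 'rV[R]_n -> 'rV[R]_n -> R) (xi : nat -> T -> 'rV[R]_n) (tau : nat),
    markov_chain P S p mu xi -> (0 < tau)%N ->
    uniformly_geometrically_ergodic P S mu xi K tau ->
    forall (f : 'rV[R]_n -> R) (M : R), (forall a, `|f a| <= M) ->
      \int[P]_w f (xi 0 w) = 0 ->
      forall a, `|transition_op P mu xi (k0 * tau) f a| <= M / 2.
Proof.
move=> cS dmu.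
have [F [uF FS Fmass]] : exists F : seq 'rV[R]_n, [/\ uniq F,
    forall b, b \in F -> S b & 1 - 1 / 8 <= \sum_(b <- F) mu b].
  by apply: finite_mass dmu; lra.
pose b0 := 8 * (size F)%:R * `|K|.
have b0_ge0 : 0 <= b0 by rewrite !mulr_ge0.
pose k0 := (Num.bound b0).+1.
exists k0 => // dT T P p xi tau MC tau0 erg f M fM f0 a.
pose eps := `|K| / 2 ^+ k0.
have p2 : 0 < 2 ^+ k0 :> R by rewrite exprn_gt0.
have e0 : 0 <= eps by rewrite divr_ge0 // ltW.
have M0 : 0 <= M by apply: le_trans (fM 0).
have eps_small : 2 * (size F)%:R * eps <= 1 / 4.
  rewrite /eps mulrA ler_pdivrMr //.
  have : b0 <= 2 ^+ k0.
    apply: (le_trans (ltW (archi_boundP b0_ge0))).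
    by rewrite -natrX ler_nat ltnW // (leq_trans _ (ltn_expl _ _)).
  by rewrite /b0; lra.
apply: (@le_trans _ _ (M * (2 * (1 / 8) + 2 * (size F)%:R * eps))); last first.
  by rewrite ler_wpM2l //; lra.
apply: (@transition_op_small _ _ _ _ P S cS p mu xi MC) => //.
move=> c b Sc muc bF.
have k0tau : (0 < k0 * tau)%N by rewrite muln_gt0.
have mu0 : pr P [set w | xi 0%N w = c] = mu c by rewrite /pr (mc_init MC).
have pos : (0 < P [set w | xi 0%N w = c])%E by rewrite (mc_init MC).
have := erg _ c b k0tau Sc (FS b bF) pos.
rewrite /cond_prob -/(pr P _) -/(pr P _) mu0 setIC natrM mulfK; last first.
  by rewrite pnatr_eq0 -lt0n.
rewrite powR_mulrn ?divr_ge0 // => h.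
have -> : pr P ([set w | xi 0%N w = c] `&` [set w | xi (k0 * tau)%N w = b]) -
    mu c * mu b = (pr P ([set w | xi 0%N w = c] `&`
      [set w | xi (k0 * tau)%N w = b]) / mu c - mu b) * mu c.
  by field; rewrite gt_eqF.
rewrite normrM (gtr0_norm muc) ler_wpM2r ?(ltW muc) //.
apply: (le_trans h); rewrite /eps expr_div_n expr1n mul1r ler_wpM2r ?ler_norm //.
Qed.

(** * Observables given by the dual pairing *)

Section CountableClosure.
Context (dT : measure_display) (T : measurableType dT).

Lemma countably_valued_comp (E E' : Type) (S : set E) (X : T -> E) (f : E -> E') :
  countable S -> countably_valued S X -> countably_valued (f @` S) (f \o X).
Proof.
move=> cS cX; split=> [w|a]; first by exists (X w) => //; exact: cX.1.
exact: (countably_valued_preimage cS (f @^-1` [set a]) cX).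
Qed.

Lemma countably_valued_pair (E E' : Type) (S : set E) (S' : set E')
    (X : T -> E) (X' : T -> E') :
  countably_valued S X -> countably_valued S' X' ->
  countably_valued (S `*` S') (fun w => (X w, X' w)).
Proof.
move=> cX cX'; split=> [w|[a a']]; first by split; [exact: cX.1|exact: cX'.1].
rewrite (_ : [set w | _ = _] = [set w | X w = a] `&` [set w | X' w = a']).
  by apply: measurableI; [exact: cX.2|exact: cX'.2].
by apply/seteqP; split => w /= [-> ->].
Qed.

Lemma countably_valued_sum (V : zmodType) (S : set V) (X : nat -> T -> V) m :
  countable S -> (forall t, countably_valued S (X t)) ->
  exists2 S' : set V, countable S' &
    countably_valued S' (fun w => \sum_(1 <= t < m.+1) X t w).
Proof.
move=> cS cX; elim: m => [|m [S' cS' cY]].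
  exists [set 0]; first exact: countable1.
  split=> [w|a]; first by rewrite big_geq.
  have [->|a0] := eqVneq a 0.
    rewrite (_ : [set w | _] = setT) //.
    by apply/seteqP; split => // w _ /=; rewrite big_geq.
  rewrite (_ : [set w | _] = set0) //.
  by apply/seteqP; split => // w /=; rewrite big_geq // => /esym/eqP; rewrite (negbTE a0).
exists ((fun u => u.1 + u.2) @` (S' `*` S)).
  apply: sub_countable (card_image_le _ _) _.
  by apply: countableX.
have -> : (fun w => \sum_(1 <= t < m.+2) X t w) =
    (fun u => u.1 + u.2) \o (fun w => (\sum_(1 <= t < m.+1) X t w, X m.+1 w)).
  by apply/funext => w; rewrite big_nat_recr.
apply: countably_valued_comp; first by apply: countableX.
exact: countably_valued_pair.
Qed.

End CountableClosure.

Section ScalarObservable.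
Context (R : realType) (n : nat) (dT : measure_display) (T : measurableType dT).
Context (P : probability T R).

(** The bound on the chain holds almost surely, whereas the contraction argument
    asks for observables bounded at every point; truncation changes the
    observable on a null set only. *)
Definition truncated_dotp (s : R) (v z : 'rV[R]_n) : R :=
  if `|dotp z v| <= s then dotp z v else 0.

Lemma truncated_dotp_bound s v : 0 <= s -> forall z, `|truncated_dotp s v z| <= s.
Proof. by move=> s0 z; rewrite /truncated_dotp; case: ifP; rewrite ?normr0. Qed.

Lemma ae_bounded_integrable (Y : T -> R) (M : R) :
  measurable_fun setT Y -> {ae P, forall w, `|Y w| <= M} ->
  P.-integrable setT (EFin \o Y).
Proof.
move=> mY aeY; apply/integrableP; split; first exact/measurable_EFinP.
apply: (@le_lt_trans _ _ (\int[P]_w (`|M|)%:E)%E); last first.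
  by rewrite integral_cst //= probability_setT mule1 ltry.
apply: ae_ge0_le_integral => //.
- by apply: measurableT_comp => //; exact/measurable_EFinP.
- apply: filterS aeY => w /= Yw _; rewrite lee_fin.
  by rewrite (le_trans Yw) // ler_norm.
Qed.

End ScalarObservable.

Section CentredObservable.
Context (R : realType) (n : nat) (dT : measure_display) (T : measurableType dT).
Context (P : probability T R) (S : set 'rV[R]_n) (S_countable : countable S).
Context (nrm : 'rV[R]_n -> R) (Hn : is_norm nrm) (sigma : R) (X : T -> 'rV[R]_n).
Hypothesis cX : countably_valued S X.
Hypothesis mean0 : forall i, ('E_P[fun w => (X w 0 i)%R] = 0)%E.
Hypothesis bound : {ae P, forall w, dual_norm nrm (X w) ^+ 2 <= sigma ^+ 2}.

Lemma dual_norm_le_ae : {ae P, forall w, dual_norm nrm (X w) <= `|sigma|}.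
Proof.
apply: filterS bound => w h.
by rewrite -ler_sqr ?nnegrE ?(dual_norm_ge0 Hn) // real_normK ?num_real.
Qed.

Lemma truncated_dotp_ae v : nrm v <= 1 ->
  {ae P, forall w, truncated_dotp `|sigma| v (X w) = dotp (X w) v}.
Proof.
move=> v1; apply: filterS dual_norm_le_ae => w h.
by rewrite /truncated_dotp (le_trans (dotp_le_dual_norm Hn _ v1) h).
Qed.

(** The expectation of a non-integrable function is a default value, so the
    centring hypothesis becomes linear only through integrability, which the
    almost sure bound on the dual norm provides. *)
Lemma coord_integrable i : P.-integrable setT (EFin \o (fun w => X w 0 i)).
Proof.
have [M M0 bM] := norm_le_nrm Hn.
pose e : 'rV[R]_n := delta_mx 0 i.
have de w : dotp (X w) e = X w 0 i.
  rewrite /dotp (bigD1 i) //= big1 => [|j ji]; rewrite !mxE /= ?eqxx ?mulr1 ?addr0 //.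
  by rewrite (negbTE ji) mulr0.
have ne0 : e != 0.
  apply/eqP => /rowP/(_ i); rewrite !mxE !eqxx /= => /eqP.
  by rewrite oner_eq0.
have ne := nrm_gt0 Hn ne0.
apply: (@ae_bounded_integrable _ _ _ P _ (nrm e * `|sigma|)).
  exact: (countably_valued_measurable S_countable (fun z => z 0 i) cX).
apply: filterS dual_norm_le_ae => w h.
have -> : X w 0 i = nrm e * dotp (X w) ((nrm e)^-1 *: e).
  by rewrite dotpZr de mulrA mulfV ?gt_eqF // mul1r.
rewrite normrM (gtr0_norm ne) ler_wpM2l ?(ltW ne) // (le_trans _ h) //.
apply: (dotp_le_dual_norm Hn).
by rewrite is_norm_homo // normfV gtr0_norm // mulVf // gt_eqF.
Qed.

Lemma truncated_dotp_centred v : nrm v <= 1 ->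
  \int[P]_w truncated_dotp `|sigma| v (X w) = 0.
Proof.
move=> v1; transitivity (\int[P]_w dotp (X w) v).
  congr fine; apply: ae_eq_integral => //.
  - exact/measurable_EFinP/(countably_valued_measurable S_countable _ cX).
  - exact/measurable_EFinP/(countably_valued_measurable S_countable (fun z => dotp z v) cX).
  - by apply: filterS (truncated_dotp_ae v1) => w + _ => ->.
rewrite /dotp Rintegral_sum => [|i].
  apply: big1 => i _; rewrite RintegralZr //; last exact: coord_integrable.
  have := mean0 i; rewrite unlock /Rintegral => ->.
  by rewrite /= mul0r.
have -> : EFin \o (fun w => X w 0 i * v 0 i) =
    (fun w => (v 0%R i)%:E * (EFin \o (fun w => X w 0%R i)) w)%E.
  by apply/funext => w /=; rewrite -EFinM mulrC.
exact/integrableZl/coord_integrable.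
Qed.

End CentredObservable.

(** * The mean of the chain in the dual norm *)

Theorem lemma1 (R : realType) (d : nat) (d_gt0 : (0 < d)%N)
    (S : set 'rV[R]_d) (S_countable : countable S)
    (pi_ : 'rV[R]_d -> R) (K : R) :
  exists C : R, 0 < C /\
  forall (nrm : 'rV[R]_d -> R), is_norm nrm ->
  forall (omega : 'rV[R]_d -> \bar R) (omega' : 'rV[R]_d -> 'rV[R]_d),
    distance_generating nrm omega omega' ->
    subdifferential omega 0 !=set0 ->
  forall (dT : measure_display) (T : measurableType dT) (P : probability T R)
         (p : 'rV[R]_d -> 'rV[R]_d -> R) (xi : nat -> T -> 'rV[R]_d)
         (sigma : R) (tau_mix : nat),
    transition_matrix S p ->
    unique_invariant_distribution S p pi_ ->
    markov_chain P S p pi_ xi ->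
    (0 < tau_mix)%N ->
    uniformly_geometrically_ergodic P S pi_ xi K tau_mix ->
    (forall (t : nat) (i : 'I_d), ('E_P[fun w => (xi t w 0 i)%R] = 0)%E) ->
    (forall t : nat, {ae P, forall w, dual_norm nrm (xi t w) ^+ 2 <= sigma ^+ 2}) ->
  forall N : nat, (1 <= N)%N ->
    ('E_P[fun w => (dual_norm nrm (N%:R^-1 *: \sum_(1 <= t < N.+1) xi t w) ^+ 2)%R]
       <= (C * N%:R^-1)%:E * bregman_radius2 nrm omega omega'
            * (sigma ^+ 2 * tau_mix%:R)%:E)%E.
Proof.
have [dpi|ndpi] := pselect (distribution_on S pi_); last first.
  exists 1; split => // nrm Hn omega omega' dg sub0 dT T P p xi sigma tau tm.
  by move=> [/ndpi].
have [k0 k0_gt0 contr] := ergodic_contraction K S_countable dpi.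
have k0R : 0 < k0%:R :> R by rewrite ltr0n.
have dR : 0 < d%:R :> R by rewrite ltr0n.
exists (64 * d%:R ^+ 2 * k0%:R); split; first by rewrite !mulr_gt0 ?exprn_gt0.
move=> nrm Hn omega omega' dg sub0 dT T P p xi sigma tau _ [_ pi_inv _] MC.
move=> tau_gt0 erg mean0 bnd N N_gt0.
have NR : 0 < N%:R :> R by rewrite ltr0n.
have [Z bZ hZ] := near_auerbach_basis Hn.
have cX := chain_countably_valued MC.
pose f i := truncated_dotp `|sigma| (row i Z).
have fM i : forall z, `|f i z| <= `|sigma| by exact: truncated_dotp_bound.
have f0 i : \int[P]_w f i (xi 0 w) = 0.
  exact: (truncated_dotp_centred S_countable Hn (cX 0%N) (mean0 0%N) (bnd 0%N)).
have T0_gt0 : (0 < k0 * tau)%N by rewrite muln_gt0 k0_gt0.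
pose Y i w := \sum_(1 <= t < N.+1) f i (xi t w).
have varY i : \int[P]_w (Y i w ^+ 2) <= 4 * (k0 * tau)%:R * sigma ^+ 2 * N%:R.
  rewrite -(real_normK (num_real sigma)).
  exact: (variance_sum_le S_countable MC pi_inv T0_gt0
    (contr _ _ _ _ _ _ MC tau_gt0 erg) N (fM i) (f0 i)).
have mY i : measurable_fun setT (Y i).
  by apply: measurable_sum => t; exact: (countably_valued_measurable S_countable _ (cX t)).
have bY i w : `|Y i w| <= `|sigma| * N%:R.
  apply: (le_trans (ler_norm_sum _ _ _)).
  apply: (@le_trans _ _ (\sum_(1 <= t < N.+1) `|sigma|)); first exact: ler_sum.
  by rewrite sumr_const_nat subn1 /= mulr_natr.
have iY i : P.-integrable setT (EFin \o (fun w => Y i w ^+ 2)).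
  apply: (@bounded_integrable _ _ _ P _ ((`|sigma| * N%:R) ^+ 2)) => //.
    exact: measurable_funX.
  by move=> w; rewrite normrX ler_sqr ?nnegrE ?mulr_ge0.
have aeY : {ae P, forall w, forall i, dotp (\sum_(1 <= t < N.+1) xi t w) (row i Z) = Y i w}.
  have : {ae P, forall w, forall (t : 'I_N.+1) i, f i (xi t w) = dotp (xi t w) (row i Z)}.
    apply: filter_forall => t; apply: filter_forall => i.
    exact: (truncated_dotp_ae Hn (bnd t) (bZ i)).
  apply: filterS => w h i; rewrite dotp_suml /Y; apply: eq_big_nat => t /andP[_ tN].
  by rewrite -(h (Ordinal tN)).
pose G w := 4 * d%:R * N%:R^-1 ^+ 2 * \sum_i Y i w ^+ 2.
have iS : P.-integrable setT (EFin \o (fun w => \sum_i Y i w ^+ 2)).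
  rewrite (_ : _ \o _ = (fun w => \sum_i (EFin \o (fun w => (Y i w ^+ 2)%R)) w)%E).
    by apply: integrable_sum.
  by apply/funext => w /=; rewrite sumEFin.
have bound : ('E_P[fun w => (dual_norm nrm (N%:R^-1 *: \sum_(1 <= t < N.+1) xi t w) ^+ 2)%R]
    <= (16 * d%:R ^+ 2 * k0%:R * N%:R^-1 * (sigma ^+ 2 * tau%:R))%:E)%E.
  rewrite unlock; apply: (@le_trans _ _ (\int[P]_w (G w)%:E)%E).
    have [S' cS' cZ] := countably_valued_sum N S_countable cX.
    apply: ae_ge0_le_integral => //.
    - by move=> w _; rewrite lee_fin sqr_ge0.
    - apply/measurable_EFinP.
      exact: (countably_valued_measurable cS'
        (fun z => dual_norm nrm (N%:R^-1 *: z) ^+ 2) cZ).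
    - move=> w _; rewrite lee_fin mulr_ge0 //.
      by apply: sumr_ge0 => i _; exact: sqr_ge0.
    - apply/measurable_EFinP; apply: measurable_funM => //.
      by apply: measurable_sum => i; exact: measurable_funX.
    apply: filterS aeY => w h _; rewrite lee_fin.
    apply: (le_trans (dual_norm_sqr_le Hn _ hZ)).
    rewrite /G -[leRHS]mulrA ler_wpM2l ?mulr_ge0 // mulr_sumr.
    by apply: ler_sum => i _; rewrite dotpZl h exprMn.
  have -> : (\int[P]_w (G w)%:E = (\int[P]_w G w)%:E)%E.
    rewrite fineK //; apply: integrable_fin_num => //.
    exact: (integrableZl measurableT (4 * d%:R * N%:R^-1 ^+ 2) iS).
  rewrite lee_fin /G RintegralZl // Rintegral_sum //.
  apply: (@le_trans _ _ (4 * d%:R * N%:R^-1 ^+ 2 *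
      \sum_(i < d) (4 * (k0 * tau)%:R * sigma ^+ 2 * N%:R))).
    apply: ler_wpM2l; first by rewrite !mulr_ge0 ?exprn_ge0 ?invr_ge0.
    exact: ler_sum.
  rewrite sumr_const card_ord -[X in _ * X]mulr_natl natrM le_eqVlt; apply/orP; left.
  by apply/eqP; field; rewrite gt_eqF.
apply: (le_trans bound).
(* The radius may be infinite while sigma = 0: the comparison takes place in the
   extended reals, where the right-hand side is then 0. *)
have rad := bregman_radius2_ge d_gt0 Hn dg sub0.
have C0 : (0 <= (64 * d%:R ^+ 2 * k0%:R * N%:R^-1)%:E :> \bar R)%E.
  by rewrite lee_fin !mulr_ge0 ?exprn_ge0 ?invr_ge0 ?ltW.
have s0 : (0 <= (sigma ^+ 2 * tau%:R)%:E :> \bar R)%E.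
  by rewrite lee_fin mulr_ge0 ?sqr_ge0.
apply: (le_trans _ (lee_wpmul2r s0 (lee_wpmul2l C0 rad))).
rewrite -!EFinM lee_fin le_eqVlt; apply/orP; left; apply/eqP.
by field; rewrite gt_eqF.
Qed.
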